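(* Let $K$ be any field, let $p\ge 0$ be an integer and $m=2p+1$. Let $L:K^m\to\operatorname{Hom}(\bigwedge^pK^m,\bigwedge^{p+1}K^m)$ be the linear map given by $L(v)(w)=v\wedge w$, and let $\mathcal X_L$ be its image, a linear subspace of the space of $\binom{2p+1}{p}\times\binom{2p+1}{p}$ matrices over $K$. Then: (1) $\operatorname{rk}(\mathcal X_L)=\binom{2p}{p}$; (2) $\operatorname{rk}(\mathcal X_L^{\{m+1\}})$ is full, i.e. equal to $(m+1)\binom{2p+1}{p}$; (3) $\operatorname{rk}(\mathcal X_L^{\{m\}})>\binom{2p}{p}(2m-4)$.
   Context: $\operatorname{Mat}_{r,s}$ denotes the space of $r\times s$ matrices over $K$. After choosing bases, $\operatorname{Hom}(\bigwedge^pK^m,\bigwedge^{p+1}K^m)$ is identified with $\operatorname{Mat}_{D,D}$, $D=\binom{2p+1}{p}$. For a linear subspace $\mathcal X\subseteq\operatorname{Mat}_{r,s}$, its rank is $\operatorname{rk}(\mathcal X)=\max\{\operatorname{rk}(X)\mid X\in\mathcal X\}$. Its $(a,b)$ tensor blow-up is $\mathcal X^{\{a,b\}}=\mathcal X\otimes\operatorname{Mat}_{a,b}=\{\sum_iX_i\otimes T_i\mid X_i\in\mathcal X,\ T_i\in\operatorname{Mat}_{a,b}\}$ (Kronecker products), viewed as a linear subspace of $\operatorname{Mat}_{ra,sb}$, and $\mathcal X^{\{d\}}:=\mathcal X^{\{d,d\}}$. *)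

(* Defs.v *)
From HB Require Import structures.
From mathcomp Require Import all_boot all_order all_algebra.
From mathcomp Require Import boolp.
From mathcomp Require Import mxtens.

Set Implicit Arguments.
Unset Strict Implicit.
Unset Printing Implicit Defensive.

Import GRing.Theory.
Local Open Scope ring_scope.

(* The exterior algebra of K^m, on the basis e_A (A a subset of {0..m-1});
   e_A stands for the wedge of the e_i, i in A, in increasing order. *)
Definition exterior (K : fieldType) (m : nat) := {ffun {set 'I_m} -> K^o}.

Section Exterior.
Variables (K : fieldType) (m : nat).
Implicit Types (A B C : {set 'I_m}) (u v w : exterior K m).

Definition ebasis A : exterior K m := [ffun B => (A == B)%:R].

(* Number of inversions created by concatenating A and B. *)
Definition inversions A B : nat := (\sum_(i in A) \sum_(j in B) (j < i)%N)%N.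

(* Bilinear extension of: e_A /\ e_B = 0 if A and B meet, and
   (-1)^(inversions A B) e_(A u B) otherwise. *)
Definition wedge u v : exterior K m :=
  \sum_(A : {set 'I_m}) \sum_(B : {set 'I_m} | [disjoint A & B])
    ((-1) ^+ inversions A B * (u A * v B)) *: ebasis (A :|: B).

Definition evec (x : 'rV[K]_m) : exterior K m :=
  \sum_(i < m) x 0 i *: ebasis [set i].

Definition extpow (p : nat) : {vspace exterior K m} :=
  <<[seq ebasis A | A : {set 'I_m} in [pred A : {set 'I_m} | #|A| == p]]>>%VS.

(* vsproj only retypes the product, which lies in extpow p.+1: see leftwedgeE. *)
Definition leftwedge (p : nat) (x : 'rV[K]_m) :
    'Hom(subvs_of (extpow p), subvs_of (extpow p.+1)) :=
  linfun (fun w : subvs_of (extpow p) => vsproj (extpow p.+1) (wedge (evec x) (vsval w))).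

Lemma exterior_sum u : u = \sum_A u A *: ebasis A.
Proof.
apply/ffunP => B; rewrite sum_ffunE (bigD1 B) //= !ffunE eqxx [_ *: _]mulr1.
by rewrite big1 ?addr0 // => A /negPf nAB; rewrite !ffunE nAB [_ *: _]mulr0.
Qed.

Lemma wedge_is_linearl v : linear (wedge^~ v).
Proof.
move=> a u u'; rewrite /wedge scaler_sumr -big_split; apply: eq_bigr => A _ /=.
rewrite scaler_sumr -big_split; apply: eq_bigr => B _ /=.
rewrite !ffunE scalerA -scalerDl; congr (_ *: _).
by rewrite mulrDl mulrDr [in LHS]/GRing.scale /= -!mulrA [in LHS]mulrCA.
Qed.

Lemma wedge_is_linearr u : linear (wedge u).
Proof.
move=> a v v'; rewrite /wedge scaler_sumr -big_split; apply: eq_bigr => A _ /=.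
rewrite scaler_sumr -big_split; apply: eq_bigr => B _ /=.
rewrite !ffunE scalerA -scalerDl; congr (_ *: _).
by rewrite !mulrDr [in LHS]/GRing.scale /= [u A * (a * _)]mulrCA [in LHS](mulrCA _ a).
Qed.

HB.instance Definition _ u := GRing.isLinear.Build K (exterior K m)
  (exterior K m) *:%R (wedge u) (wedge_is_linearr u).

Lemma wedgeDl v u u' : wedge (u + u') v = wedge u v + wedge u' v.
Proof. by have := wedge_is_linearl v 1 u u'; rewrite !scale1r. Qed.

Lemma wedge0l v : wedge 0 v = 0.
Proof. by have := wedge_is_linearl v (-1) 0 0; rewrite scaler0 addr0 scaleN1r addNr. Qed.

Lemma wedgeZl a u v : wedge (a *: u) v = a *: wedge u v.
Proof. by have := wedge_is_linearl v a u 0; rewrite !addr0 wedge0l addr0. Qed.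

Lemma wedge_suml (I : finType) (P : pred I) (F : I -> exterior K m) v :
  wedge (\sum_(i | P i) F i) v = \sum_(i | P i) wedge (F i) v.
Proof.
by apply: (big_morph (wedge^~ v)) => [x y|]; rewrite ?wedgeDl ?wedge0l.
Qed.

Lemma wedge_sumr (I : finType) (P : pred I) u (F : I -> exterior K m) :
  wedge u (\sum_(i | P i) F i) = \sum_(i | P i) wedge u (F i).
Proof. exact: linear_sum. Qed.

Lemma wedgeZr a u v : wedge u (a *: v) = a *: wedge u v.
Proof. exact: linearZ. Qed.

Lemma wedge_basis A B : wedge (ebasis A) (ebasis B) =
  if [disjoint A & B] then (-1) ^+ inversions A B *: ebasis (A :|: B) else 0.
Proof.
rewrite /wedge (bigD1 A) //= [X in _ + X]big1 ?addr0; last first.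
  move=> A' /negPf nA; rewrite big1 // => B' _.
  by rewrite !ffunE eq_sym nA mul0r mulr0 scale0r.
case: ifPn => dAB.
  rewrite (bigD1 B) //= big1 ?addr0; first by rewrite !ffunE !eqxx !mulr1.
  by move=> B' /andP[_ /negPf nB]; rewrite !ffunE [B == _]eq_sym nB !mulr0 scale0r.
rewrite big1 // => B' dB'; rewrite !ffunE.
have /negPf-> : B != B' by apply: contraNneq dAB => ->.
by rewrite !mulr0 scale0r.
Qed.

Lemma disjoint_setUl A B C :
  [disjoint A :|: B & C] = [disjoint A & C] && [disjoint B & C].
Proof. by rewrite -!setI_eq0 setIUl setU_eq0. Qed.

Lemma disjoint_setUr A B C :
  [disjoint A & B :|: C] = [disjoint A & B] && [disjoint A & C].
Proof. by rewrite -!setI_eq0 setIUr setU_eq0. Qed.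

Lemma inversionsUl A B C : [disjoint A & B] ->
  inversions (A :|: B) C = (inversions A C + inversions B C)%N.
Proof.
move=> dAB; rewrite /inversions -bigU //=.
by apply: eq_bigl => i; rewrite !inE.
Qed.

Lemma inversionsUr A B C : [disjoint B & C] ->
  inversions A (B :|: C) = (inversions A B + inversions A C)%N.
Proof.
move=> dBC; rewrite /inversions -big_split /=; apply: eq_bigr => i _.
by rewrite -bigU //=; apply: eq_bigl => j; rewrite !inE.
Qed.

Lemma wedgeA : associative wedge.
Proof.
pose expand t := (fun A => t A *: ebasis A) : {set 'I_m} -> exterior K m.
move=> u v w; rewrite (exterior_sum u) !(wedge_suml _ (expand u)) wedge_suml.
apply: eq_bigr => A _; rewrite /expand !wedgeZl; congr (_ *: _).
rewrite (exterior_sum v) (wedge_suml _ (expand v)) !wedge_sumr.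
rewrite wedge_suml.
apply: eq_bigr => B _; rewrite /expand !(wedgeZl, wedgeZr); congr (_ *: _).
rewrite (exterior_sum w) !(wedge_sumr _ _ (expand w)) wedge_sumr.
apply: eq_bigr => C _; rewrite /expand !wedgeZr; congr (_ *: _).
rewrite !wedge_basis.
have [dAC|/negPf nAC] := boolP [disjoint A & C];
have [dBC|/negPf nBC] := boolP [disjoint B & C];
have [dAB|/negPf nAB] := boolP [disjoint A & B];
  rewrite ?linear0 ?wedge0l ?linearZ ?wedgeZl //= !wedge_basis
    ?disjoint_setUl ?disjoint_setUr ?dAC ?dBC ?dAB ?nAC ?nBC ?nAB
    ?andbF //= ?scaler0 //.
rewrite inversionsUl // inversionsUr // setUA !scalerA -!exprD.
by rewrite [X in _ ^+ X *: _ = _]addnC addnA.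
Qed.

Lemma wedge1l u : wedge (ebasis set0) u = u.
Proof.
rewrite [in RHS](exterior_sum u) {1}(exterior_sum u) wedge_sumr.
apply: eq_bigr => A _; rewrite wedgeZr wedge_basis -setI_eq0 set0I eqxx.
by rewrite /inversions big_set0 set0U scale1r.
Qed.

Lemma wedge1r u : wedge u (ebasis set0) = u.
Proof.
rewrite [in RHS](exterior_sum u) {1}(exterior_sum u) wedge_suml.
apply: eq_bigr => A _; rewrite wedgeZl wedge_basis -setI_eq0 setI0 eqxx.
by rewrite /inversions big1 => [|i _]; rewrite ?big_set0 // setU0 scale1r.
Qed.

Lemma ebasis_cons (i : 'I_m) A : {in A, forall j : 'I_m, (i < j)%N} ->
  ebasis (i |: A) = wedge (ebasis [set i]) (ebasis A).
Proof.
move=> ltiA; rewrite wedge_basis disjoints1.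
case: (boolP (i \in A)) => [/ltiA|_]; first by rewrite ltnn.
rewrite /inversions big_set1 big1 ?scale1r // => j /ltiA.
by rewrite ltnNge => /negPf; rewrite leq_eqVlt => /norP[_ /negPf->].
Qed.

Lemma evec_is_linear : linear evec.
Proof.
move=> a x y; rewrite /evec scaler_sumr -big_split; apply: eq_bigr => i _.
by rewrite !mxE scalerDl scalerA.
Qed.

HB.instance Definition _ := GRing.isLinear.Build K 'rV[K]_m
  (exterior K m) *:%R evec evec_is_linear.

Lemma wedge_evecxx (x : 'rV[K]_m) : wedge (evec x) (evec x) = 0.
Proof.
pose F i j := x 0 i *: (x 0 j *: wedge (ebasis [set i]) (ebasis [set j])).
have FC (i j : 'I_m) : (i < j)%N -> F j i = - F i j.
  move=> ltij; have ne : i != j by rewrite neq_ltn ltij.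
  rewrite /F !wedge_basis !disjoints1 !inE eq_sym ne.
  rewrite /inversions !big_set1 ltij [(j < i)%N]ltnNge (ltnW ltij) /=.
  by rewrite setUC scale1r expr1 scaleN1r !scalerN !scalerA mulrC.
rewrite /evec wedge_suml.
under eq_bigr do rewrite wedgeZl wedge_sumr scaler_sumr.
under eq_bigr => i _ do under eq_bigr => j _ do rewrite wedgeZr -/(F i j).
pose s := \sum_(i < m) \sum_(j < m | (i < j)%N) F i j.
transitivity (s - s); last exact: subrr.
rewrite {2}/s [in X in _ - X](exchange_big_dep xpredT) //= -sumrN -big_split.
apply: eq_bigr => i _ /=; rewrite -sumrN.
rewrite (bigID (fun j : 'I_m => (i < j)%N)) /=; congr (_ + _).
rewrite (bigD1 i) ?ltnn //= {1}/F wedge_basis disjoints1 inE eqxx !scaler0 add0r.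
apply: eq_big => [j|j /andP[]]; first by rewrite -leqNgt ltn_neqAle andbC.
by rewrite -leqNgt => le ne; rewrite FC // ltn_neqAle ne.
Qed.

Lemma mem_ebasis A : ebasis A \in extpow #|A|.
Proof. by apply/memv_span/imageP; exists A; rewrite ?inE. Qed.

Lemma evec_extpow (x : 'rV[K]_m) : evec x \in extpow 1.
Proof.
by apply: memv_suml => i _; rewrite memvZ // -(cards1 i) mem_ebasis.
Qed.

Lemma extpowP p u :
  reflect (forall A, #|A| != p -> u A = 0) (u \in extpow p).
Proof.
apply: (iffP idP) => [|u0].
  rewrite /extpow; set X := image _ _ => Xu A nA.
  rewrite (coord_span (X := in_tuple X) Xu) sum_ffunE big1 // => i _.
  rewrite ffunE /=.
  have /imageP[B /eqP cB ->] : X`_i \in X by apply: mem_nth.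
  rewrite ffunE; case: eqP => [eBA|_]; last exact: mulr0.
  by rewrite -eBA cB eqxx in nA.
rewrite (exterior_sum u) memv_suml // => A _.
have [<-|/u0->] := eqVneq #|A| p; last by rewrite scale0r mem0v.
by rewrite memvZ // mem_ebasis.
Qed.

Lemma wedge_extpow p q u v :
  u \in extpow p -> v \in extpow q -> wedge u v \in extpow (p + q).
Proof.
move=> /extpowP u0 /extpowP v0; apply: memv_suml => A _; apply: memv_suml => B dAB.
have [cA|/u0->] := eqVneq #|A| p; last by rewrite mul0r mulr0 scale0r mem0v.
have [cB|/v0->] := eqVneq #|B| q; last by rewrite !mulr0 scale0r mem0v.
have /eqP <- : #|A :|: B| == (p + q)%N.
  by rewrite -cA -cB (leq_card_setU A B).2.
by rewrite memvZ // mem_ebasis.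
Qed.

Lemma dim_extpow p : \dim (extpow p) = 'C(m, p).
Proof.
have /eqP-> : free [seq ebasis A | A : {set 'I_m} in [pred A : {set 'I_m} | #|A| == p]].
  set X := image _ _.
  have: free (in_tuple X); last by [].
  apply/freeP => k k0 i.
  have /imageP[A pA XiA] : X`_i \in X by apply: mem_nth.
  have uX : uniq X.
    rewrite map_inj_uniq ?enum_uniq // => B C /ffunP/(_ C).
    by rewrite !ffunE eqxx; case: eqP => // _ /esym/eqP; rewrite oner_eq0.
  move/ffunP: k0 => /(_ A); rewrite sum_ffunE (bigD1 i) //= big1 ?addr0.
    by rewrite !ffunE XiA ffunE eqxx [_ *: _]mulr1.
  move=> j ji; rewrite ffunE.
  have /imageP[B pB XjB] : X`_j \in X by apply: mem_nth.
  rewrite XjB ffunE; case: eqP => [eBA|_]; last exact: mulr0.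
  by case/negP: ji; rewrite -val_eqE -(nth_uniq 0 _ _ uX) ?ltn_ord //= XjB eBA XiA.
rewrite size_map -cardE -[in RHS](card_ord m) -card_draws -cardsE.
by apply: eq_card => A; rewrite !inE.
Qed.

Lemma leftwedgeE p (x : 'rV[K]_m) (w : subvs_of (extpow p)) :
  vsval (leftwedge p x w) = wedge (evec x) (vsval w).
Proof.
pose f (w : subvs_of (extpow p)) := vsproj (extpow p.+1) (wedge (evec x) (vsval w)).
have flin : linear f by move=> a y z; rewrite /f !linearP.
pose fL := GRing.isLinear.Build K _ _ *:%R f flin.
pose ff : {linear _ -> _} := HB.pack f fL.
rewrite /leftwedge (lfunE ff) /= vsprojK // -(add1n p).
exact: wedge_extpow (evec_extpow x) (subvsP w).
Qed.

Lemma leftwedge_is_linear p : linear (leftwedge p).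
Proof.
move=> a x y; apply/lfunP => w; apply: val_inj; rewrite add_lfunE scale_lfunE.
by rewrite /= !leftwedgeE linearP wedgeDl wedgeZl.
Qed.

HB.instance Definition _ p := GRing.isLinear.Build K 'rV[K]_m
  'Hom(subvs_of (extpow p), subvs_of (extpow p.+1)) *:%R (leftwedge p)
  (@leftwedge_is_linear p).

End Exterior.

Arguments extpow K m p : clear implicits.
Arguments leftwedge {K m} p x.

Section MatrixSpaces.
Variable K : fieldType.

(* Matrix of h for the bases e of U and f of V; the j-th column holds the
   coordinates of h e_j. *)
Definition hom_mx (U V : vectType K) (s r : nat) (e : s.-tuple U)
    (f : r.-tuple V) (h : 'Hom(U, V)) : 'M[K]_(r, s) :=
  \matrix_(i < r, j < s) coord f i (h e`_j).

Lemma hom_mx_is_linear U V s r e f : linear (@hom_mx U V s r e f).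
Proof.
by move=> a g h; apply/matrixP => i j; rewrite !mxE add_lfunE scale_lfunE linearP.
Qed.

HB.instance Definition _ (U V : vectType K) s r (e : s.-tuple U)
    (f : r.-tuple V) := GRing.isLinear.Build K 'Hom(U, V) 'M[K]_(r, s) *:%R
  (hom_mx e f) (hom_mx_is_linear e f).

Definition mxspace_rank (r s : nat) (X : {vspace 'M[K]_(r, s)}) : nat :=
  \max_(k < (minn r s).+1 | `[< exists2 A, A \in X & \rank A = k >]) k.

Lemma mxspace_rankP r s (X : {vspace 'M[K]_(r, s)}) :
  (exists2 A, A \in X & \rank A = mxspace_rank X) /\
  (forall A, A \in X -> (\rank A <= mxspace_rank X)%N).
Proof.
pose P (k : 'I_(minn r s).+1) := `[< exists2 A, A \in X & \rank A = k >].
have lt_rank (A : 'M[K]_(r, s)) : (\rank A < (minn r s).+1)%N.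
  by rewrite ltnS leq_min rank_leq_row rank_leq_col.
split=> [|A XA]; last first.
  by apply: (@leq_bigmax_cond _ P val (Ordinal (lt_rank A))); apply/asboolP; exists A.
have /(eq_bigmax_cond val)[k /asboolP Pk eqk] : (0 < #|P|)%N.
  apply/card_gt0P; exists (Ordinal (lt_rank 0)); apply/asboolP.
  by exists 0; rewrite ?mem0v.
by rewrite /mxspace_rank [bigop _ _ _]eqk.
Qed.

(* The span of the Kronecker products A *t T, A in X and T in Mat_{a,b}. *)
Definition blowup (r s : nat) (X : {vspace 'M[K]_(r, s)}) (a b : nat) :
    {vspace 'M[K]_(r * a, s * b)} :=
  <<[seq A *t T | A <- vbasis X, T <- vbasis {:'M[K]_(a, b)}]>>%VS.

Lemma tensmx_is_linearl r s a b (T : 'M[K]_(a, b)) :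
  linear (fun A : 'M[K]_(r, s) => A *t T).
Proof.
by move=> c A B; apply/matrixP => i j; rewrite !mxE mulrDl mulrA.
Qed.

Lemma tensmx_is_linearr r s a b (A : 'M[K]_(r, s)) :
  linear (fun T : 'M[K]_(a, b) => A *t T).
Proof.
by move=> c T U; apply/matrixP => i j; rewrite !mxE mulrDr mulrCA.
Qed.

Lemma mem_tensmx r s (X : {vspace 'M[K]_(r, s)}) a b A (T : 'M[K]_(a, b)) :
  A \in X -> A *t T \in blowup X a b.
Proof.
pose lin_l (U : 'M[K]_(a, b)) : {linear 'M[K]_(r, s) -> 'M[K]_(r * a, s * b)} :=
  HB.pack (fun B : 'M[K]_(r, s) => B *t U) (GRing.isLinear.Build K _ _ *:%R _ (tensmx_is_linearl U)).
pose lin_r (B : 'M[K]_(r, s)) : {linear 'M[K]_(a, b) -> 'M[K]_(r * a, s * b)} :=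
  HB.pack (fun U : 'M[K]_(a, b) => B *t U) (GRing.isLinear.Build K _ _ *:%R _ (tensmx_is_linearr B)).
move=> XA; rewrite (coord_vbasis XA) -[_ *t T]/(lin_l T _) linear_sum.
apply: memv_suml => i _; rewrite linearZ memvZ //=.
rewrite (coord_vbasis (memvf T)) -[_ *t _]/(lin_r _ _) linear_sum.
apply: memv_suml => j _; rewrite linearZ memvZ //=.
by apply/memv_span/allpairs_f; apply: mem_nth; rewrite size_tuple.
Qed.

Lemma blowupP r s (X : {vspace 'M[K]_(r, s)}) a b (Y : 'M[K]_(r * a, s * b)) :
  Y \in blowup X a b <->
  exists (n : nat) (A : 'I_n -> 'M[K]_(r, s)) (T : 'I_n -> 'M[K]_(a, b)),
    (forall i, A i \in X) /\ Y = \sum_(i < n) A i *t T i.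
Proof.
split=> [|[n [A [T [XA ->]]]]]; last first.
  by apply: memv_suml => i _; apply: mem_tensmx.
rewrite /blowup; set S := (X in <<X>>%VS) => SY.
have /fin_all_exists2[AT XAT SAT] (i : 'I_(size S)) :
    exists2 AT : 'M[K]_(r, s) * 'M[K]_(a, b), AT.1 \in X & S`_i = AT.1 *t AT.2.
  have /allpairsP[[A T] /= [XA _ ->]] : S`_i \in S by apply: mem_nth.
  by exists (A, T); rewrite //= vbasis_mem.
exists (size S), (fun i => coord (in_tuple S) i Y *: (AT i).1), (fun i => (AT i).2).
split=> [i|]; first by rewrite memvZ.
rewrite {1}(coord_span (X := in_tuple S) SY); apply: eq_bigr => i _.
rewrite SAT; apply/matrixP => j k.
by rewrite !mxE mulrA.
Qed.

(* The image of L : K^m -> Hom(/\^p K^m, /\^(p+1) K^m), as a matrix space. *)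
Definition wedge_mxspace (m p s r : nat)
    (e : s.-tuple (subvs_of (extpow K m p)))
    (f : r.-tuple (subvs_of (extpow K m p.+1))) : {vspace 'M[K]_(r, s)} :=
  (linfun (hom_mx e f \o leftwedge p) @: fullv)%VS.

Lemma wedge_mxspaceP m p s r e f X :
  reflect (exists x : 'rV[K]_m, X = hom_mx e f (leftwedge p x))
    (X \in @wedge_mxspace m p s r e f).
Proof.
apply: (iffP memv_imgP) => [[x _ ->]|[x ->]]; exists x;
  by rewrite ?memvf ?lfunE.
Qed.

End MatrixSpaces.

(* Main.v *)
From HB Require Import structures.
Require Import Defs.
From mathcomp Require Import all_boot all_order all_algebra.
From mathcomp Require Import mxtens zify.

(** Write L(v) for the operator w |-> v /\ w from the p-th to the (p+1)-st
exterior power of K^m, with m = 2p+1, and D for the common dimension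
binomial(2p+1, p) of these two spaces.

Rank of L(v). If x_k <> 0, a multivector killed by x /\ _ is determined by
its coordinates on the sets containing k ([wedge_evec_eq0]). The kernel of L(x)
and its image both consist of such multivectors, so counting these sets bounds
the rank of L(x) from below and from above, by the same number
binomial(2p, p) ([rank_leftwedge]).

Full rank of the blow-up. The coefficients are Hankel matrices
T_k = ([i + j = k])_(0 <= i, j <= p), for k = 0, ..., 2p. That
sum_k L(e_k) (x) T_k is injective means: if
sum_i e_(i+j) /\ w_i = 0 for all j <= p, then all w_i vanish. Suppose first
that the field has m distinct elements x_k, and solve the Vandermonde system
e_l = sum_k x_k^l a_k. Put W(t) = sum_i t^i w_i, a polynomial of degree at
most p. The equations become sum_k g(x_k) (a_k /\ W(x_k)) = 0 for all
polynomials g of degree at most p. Wedging with p of the a_k kills their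
terms and leaves p+1 nodes, which g separates; so the product of any p+1 of
the a_k kills W(x_k) whenever a_k is one of its factors. This product wedged
with W(t) is then a polynomial of degree at most p with p+1 roots, so it
vanishes identically: every (p+1)-fold product of the a_k kills every w_i.
Since the a_k span K^m, every (p+1)-fold product of vectors kills w_i, that
is, w_i = 0 ([hankel_inj_points]). The Hankel matrices have entries in the
prime field, so an arbitrary K reduces to this case by extending the scalars to
K(X) ([hankel_inj]). Since m + 1 = 2(p+1), two diagonal copies of T_k give
matrices of size m+1 ([blowup_wedge_full]).

Lower bound for the m-th blow-up. Deleting the last row and column of every
coefficient matrix deletes D rows and D columns from a matrix of rank
(m+1)D, so a rank of at least (m-1)D remains ([blowup_rank_truncate]). The
bound follows from (p+1)D = (2p+1) binomial(2p, p). *)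

Set Implicit Arguments.
Unset Strict Implicit.
Unset Printing Implicit Defensive.

Import GRing.Theory.
Local Open Scope ring_scope.

(** * Exterior multiplication by vectors *)

Section VectorWedge.
Variables (K : fieldType) (m : nat).
Implicit Types (x y : 'rV[K]_m) (u v w : exterior K m).

Lemma wedge_evecE x u (B : {set 'I_m}) :
  wedge (evec x) u B =
  \sum_(i in B) (-1) ^+ inversions [set i] (B :\ i) * (x 0 i * u (B :\ i)).
Proof.
rewrite /evec wedge_suml sum_ffunE [RHS]big_mkcond /=.
apply: eq_bigr => i _; rewrite wedgeZl ffunE [u in LHS]exterior_sum wedge_sumr.
rewrite sum_ffunE.
have term A : wedge (ebasis K [set i]) (u A *: ebasis K A) B =
    if (i \notin A) && (i |: A == B)
    then (-1) ^+ inversions [set i] A * u A else 0.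
  rewrite wedgeZr wedge_basis disjoints1 ffunE.
  case: ifP => _ /=; last by rewrite ffunE [_ *: _]mulr0.
  rewrite !ffunE; case: eqP => _; last by rewrite [_ *: (_ *: _)]mulrA mulr0.
  by rewrite [_ *: (_ *: _)]mulrA mulr1 mulrC.
under eq_bigr => A _ do rewrite term.
case: ifPn => iB.
  rewrite (bigD1 (B :\ i)) //= big1 ?addr0 => [|A /negPf nA].
    by rewrite !inE eqxx setD1K // eqxx /= [_ *: _]mulrCA.
  by case: andP => // -[iA /eqP BE]; rewrite -BE setU1K ?eqxx in nA.
rewrite big1 ?[_ *: _]mulr0 // => A _.
by case: andP => // -[_ /eqP BE]; rewrite -BE setU11 in iB.
Qed.

Lemma wedge_evec_delta (l : 'I_m) u (B : {set 'I_m}) : l \notin B ->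
  wedge (evec (delta_mx 0 l)) u (l |: B) = (-1) ^+ inversions [set l] B * u B.
Proof.
move=> lB; rewrite wedge_evecE (bigD1 l) ?setU11 //= setU1K // mxE !eqxx mul1r.
rewrite big1 ?addr0 // => i /andP[_ /negPf il].
by rewrite mxE il andbF mul0r mulr0.
Qed.

Lemma wedge_evec_comb (c : 'I_m -> K) (a : 'I_m -> 'rV[K]_m) u :
  wedge (evec (\sum_k c k *: a k)) u = \sum_k c k *: wedge (evec (a k)) u.
Proof.
rewrite (linear_sum (@evec K m)) wedge_suml; apply: eq_bigr => k _.
by rewrite linearZ wedgeZl.
Qed.

Lemma wedge_evec_anticomm x y u :
  wedge (evec x) (wedge (evec y) u) = - wedge (evec y) (wedge (evec x) u).
Proof.
have := wedge_evecxx (x + y).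
rewrite linearD wedgeDl !linearD /= !wedge_evecxx add0r addr0 => xy.
by apply/eqP; rewrite -subr_eq0 opprK !wedgeA -wedgeDl xy wedge0l.
Qed.

Lemma wedge_evec2 x u : wedge (evec x) (wedge (evec x) u) = 0.
Proof. by rewrite wedgeA wedge_evecxx wedge0l. Qed.

(** If u has no coordinate on the sets containing k, the coordinate of x /\ u
on k |: S, for k outside S, is x_k u_S up to sign: all other terms of the
expansion use coordinates of u on sets containing k. *)
Lemma wedge_evec_eq0 x (k : 'I_m) u : x 0 k != 0 -> wedge (evec x) u = 0 ->
  (forall S : {set 'I_m}, k \in S -> u S = 0) -> u = 0.
Proof.
move=> xk xu0 uk; apply/ffunP => S; rewrite ffunE.
have [/uk //|kS] := boolP (k \in S).
move/ffunP/(_ (k |: S)): xu0; rewrite wedge_evecE (bigD1 k) ?setU11 //=.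
rewrite setU1K // big1 ?addr0 => [|i /andP[_ ik]]; last first.
  by rewrite (uk (_ :\ i)) ?mulr0 // !inE eq_sym ik eqxx.
move/eqP; rewrite ffunE mulf_eq0 signr_eq0 mulf_eq0 (negPf xk) /=.
by move/eqP.
Qed.

(** The factors accumulate on the left, so that prepending k to s amounts to
replacing u by a_k /\ u: the inductions below are on the length of s, for
all u. *)
Definition wedges (a : 'I_m -> 'rV[K]_m) (s : seq 'I_m) u :=
  foldl (fun v k => wedge (evec (a k)) v) u s.

Lemma wedges_is_linear a s : linear (wedges a s).
Proof.
elim: s => [|k s IHs] c u v //.
by rewrite [LHS]/= linearP; apply: IHs.
Qed.

HB.instance Definition _ a s := GRing.isLinear.Build K (exterior K m)
  (exterior K m) *:%R (wedges a s) (wedges_is_linear a s).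

Lemma wedges_cat a s t u : wedges a (s ++ t) u = wedges a t (wedges a s u).
Proof. by rewrite /wedges foldl_cat. Qed.

Lemma wedges_anticomm a s x u :
  wedge (evec x) (wedges a s u) =
  (-1) ^+ size s *: wedges a s (wedge (evec x) u).
Proof.
elim: s u => [|k s IHs] u /=; first by rewrite scale1r.
by rewrite IHs wedge_evec_anticomm linearN scalerN exprS mulN1r scaleNr.
Qed.

Lemma wedges_mem a s k u : k \in s -> wedges a s (wedge (evec (a k)) u) = 0.
Proof.
case/splitPr => s1 s2; rewrite wedges_cat /= wedges_anticomm wedge_evec2.
by rewrite !linear0.
Qed.

Lemma wedges_nuniq a s u : ~~ uniq s -> wedges a s u = 0.
Proof.
elim: s u => //= k s IHs u; rewrite negb_and negbK.
by case/orP=> [/wedges_mem//|/IHs].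
Qed.

(** The hypothesis extends by linearity from the a_k to products of n arbitrary
vectors, one factor at a time. Taking for them the basis vectors outside B
isolates the coordinate of w on B. *)
Lemma wedges_vanish a n w :
    (forall v : 'rV[K]_m, exists c : 'I_m -> K, v = \sum_k c k *: a k) ->
    (forall s, size s = n -> wedges a s w = 0) ->
  forall B : {set 'I_m}, (#|B| + n)%N = m -> w B = 0.
Proof.
move=> span_a; elim: n w => [|n IHn] w w0 B cB.
  by rewrite -[w]/(wedges a [::] w) w0 ?ffunE.
have [l lB] : exists l, l \notin B.
  apply/existsP; rewrite -negb_forall; apply: contraPN cB => /forallP allB.
  have -> : B = setT by apply/setP => l; rewrite inE; apply: allB.
  by rewrite cardsT card_ord -[RHS]addn0 => /addnI.
have: wedge (evec (delta_mx 0 l)) w (l |: B) = 0.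
  apply: IHn; last by rewrite cardsU1 lB add1n addSnnS.
  move=> s sn; have [c ->] := span_a (delta_mx 0 l).
  rewrite wedge_evec_comb linear_sum big1 // => k _; rewrite linearZ /=.
  by rewrite -[wedges a s _]/(wedges a (k :: s) w) w0 ?scaler0 //= sn.
move/eqP; rewrite wedge_evec_delta // mulf_eq0 signr_eq0.
by move/eqP.
Qed.

End VectorWedge.

(** * Injectivity of the Hankel system *)

Section Hankel.
Variables (K : fieldType) (m : nat).

(** Indexed by natural numbers, so that index arithmetic needs no bound proofs;
it is 0 from l = m on. *)
Definition nat_delta (l : nat) : 'rV[K]_m := \row_k (k == l :> nat)%:R.

Lemma nat_delta_Vandermonde (x : 'I_m -> K) : injective x ->
  exists a : 'I_m -> 'rV[K]_m, forall l, (l < m)%N ->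
    nat_delta l = \sum_k x k ^+ l *: a k.
Proof.
move=> x_inj; pose V := Vandermonde m (\row_k x k).
have Vu : V \in unitmx.
  rewrite unitmxE det_Vandermonde unitfE; apply/prodf_neq0 => i _.
  apply/prodf_neq0 => j lt_ij; rewrite !mxE subr_eq0 (inj_eq x_inj).
  by rewrite neq_ltn lt_ij orbT.
exists (fun k => row k (invmx V)) => l lt_lm.
have -> : nat_delta l = row (Ordinal lt_lm) (V *m invmx V).
  by rewrite mulmxV //; apply/rowP => k; rewrite !mxE eq_sym.
rewrite row_mul mulmx_sum_row; apply: eq_bigr => k _.
by rewrite !mxE.
Qed.

(** In the vectors a_k dual to the nodes, the Hankel tensor is a sum of rank one
terms, one for each node. With only b + c < m assumed, products of m - c of the
a_k play the role that products of p + 1 of them play in the outline above. *)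
Lemma hankel_inj_points (x : 'I_m -> K) b c (w : nat -> exterior K m) :
    injective x -> (b + c < m)%N ->
    (forall j, (j <= c)%N ->
       \sum_(i < b.+1) wedge (evec (nat_delta (i + j))) (w i) = 0) ->
  forall i (B : {set 'I_m}), (i <= b)%N -> #|B| = c -> w i B = 0.
Proof.
move=> x_inj ltbc hankel0; have [a aE] := nat_delta_Vandermonde x_inj.
pose W k := \sum_(i < b.+1) x k ^+ i *: w i.
have W0 j : (j <= c)%N -> \sum_k x k ^+ j *: wedge (evec (a k)) (W k) = 0.
  move=> le_jc; rewrite -[RHS](hankel0 _ le_jc).
  under eq_bigr => k _ do rewrite /W wedge_sumr scaler_sumr.
  rewrite exchange_big; apply: eq_bigr => i _ /=.
  rewrite aE; last by apply: leq_ltn_trans ltbc; rewrite leq_add // -ltnS.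
  rewrite wedge_evec_comb; apply: eq_bigr => k _.
  by rewrite wedgeZr scalerA exprD mulrC.
(* In the combination of the equations by the coefficients of g, the terms
   outside k :: s vanish because g does at their nodes, and the terms in s
   because wedging with s kills them; only the term of k remains. *)
have interp s k : uniq (k :: s) -> (size s + c).+1 = m ->
    wedges a s (wedge (evec (a k)) (W k)) = 0.
  move=> us sz.
  pose g : {poly K} := \prod_(l | l \notin k :: s) ('X - (x l)%:P).
  have cg : size g = c.+1.
    rewrite /g -big_filter size_prod_XsubC; congr _.+1.
    have -> : [seq l <- index_enum 'I_m | l \notin k :: s] = enum [predC k :: s].
      by rewrite /enum_mem [index_enum _]unlock; apply: eq_filter => l; rewrite !inE.
    have := cardC (mem (k :: s)); rewrite card_ord (card_uniqP us) => card_s.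
    by apply: (@addnI (size s).+1); rewrite -cardE; apply: etrans card_s (esym sz).
  have gk : g.[x k] != 0.
    rewrite horner_prod; apply/prodf_neq0 => l; rewrite !inE negb_or => /andP[lk _].
    by rewrite hornerXsubC subr_eq0 (inj_eq x_inj) eq_sym.
  have: \sum_(l < m) g.[x l] *: wedges a s (wedge (evec (a l)) (W l)) = 0.
    under eq_bigr => l _ do rewrite horner_coef cg scaler_suml.
    rewrite exchange_big big1 //= => j _.
    transitivity (g`_j *: wedges a s (\sum_l x l ^+ j *: wedge (evec (a l)) (W l))).
      rewrite linear_sum scaler_sumr; apply: eq_bigr => l _.
      by rewrite linearZ scalerA.
    by rewrite W0 ?linear0 ?scaler0 // -ltnS.
  rewrite (bigD1 k) //= big1 ?addr0 => [/eqP|l lk].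
    by rewrite scaler_eq0 (negPf gk) => /eqP.
  have [/wedges_mem->|ls] := boolP (l \in s); first by rewrite scaler0.
  rewrite /g horner_prod (bigD1 l) ?inE ?negb_or ?lk //=.
  by rewrite hornerXsubC subrr mul0r scale0r.
(* Move the factor a_k of the product next to W k. *)
have topW s k : k \in s -> (size s + c)%N = m -> uniq s -> wedges a s (W k) = 0.
  case/splitPr => s1 s2; rewrite size_cat /= addnS addSn -size_cat => sz us.
  rewrite wedges_cat /= wedges_anticomm linearZ /= -wedges_cat interp ?scaler0 //.
  by rewrite -cat1s uniq_catCA in us.
(* Coordinatewise, q is a polynomial of degree at most b that vanishes at the
   nodes of s, of which there are m - c > b. *)
have top s i : (i <= b)%N -> (size s + c)%N = m -> wedges a s (w i) = 0.
  move=> le_ib sz; have [us|/wedges_nuniq//] := boolP (uniq s).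
  apply/ffunP => B; rewrite ffunE.
  pose q : {poly K} := \poly_(l < b.+1) (wedges a s (w l) B).
  suff q0 : q = 0 by rewrite -[RHS](coef0 K i) -q0 coef_poly ltnS le_ib.
  apply: (@roots_geq_poly_eq0 _ _ [seq x k | k <- s]).
  - apply/allP => _ /mapP[k ks ->]; apply/rootP.
    have /ffunP/(_ B) := topW s k ks sz us.
    rewrite horner_poly (linear_sum (wedges a s)) sum_ffunE ffunE => WB.
    by rewrite -[RHS]WB; apply: eq_bigr => l _; rewrite linearZ ffunE mulrC.
  - by rewrite map_inj_uniq.
  rewrite size_map; apply: leq_trans (size_poly _ _) _.
  by rewrite -(leq_add2r c) sz.
move=> i B le_ib cB.
apply: (@wedges_vanish _ _ a (m - c)).
- move=> v; exists (fun k => \sum_(l < m) v 0 l * x k ^+ l).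
  rewrite {1}(row_sum_delta v).
  under [RHS]eq_bigr do rewrite scaler_suml.
  rewrite exchange_big; apply: eq_bigr => l _ /=.
  under eq_bigr do rewrite -scalerA.
  rewrite -scaler_sumr -aE //; congr (_ *: _).
  by apply/rowP => k; rewrite !mxE.
- by move=> s sz; rewrite top // sz subnK // (leq_trans _ (ltnW ltbc)) // leq_addl.
by rewrite cB subnKC // (leq_trans _ (ltnW ltbc)) // leq_addl.
Qed.

End Hankel.

(** * Descent to an arbitrary field *)

Section BaseChange.
Variables (K L : fieldType) (phi : {rmorphism K -> L}) (m : nat).

Definition map_exterior (u : exterior K m) : exterior L m :=
  [ffun A => phi (u A)].

Lemma map_wedge_evec x u :
  map_exterior (wedge (evec x) u) =
  wedge (evec (map_mx phi x)) (map_exterior u).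
Proof.
apply/ffunP => B; rewrite ffunE !wedge_evecE rmorph_sum; apply: eq_bigr => i _.
by rewrite !rmorphM rmorph_sign mxE ffunE.
Qed.

Lemma map_exterior0 : map_exterior 0 = 0.
Proof. by apply/ffunP => A; rewrite !ffunE rmorph0. Qed.

Lemma map_hankel_sum b j (w : nat -> exterior K m) :
  map_exterior (\sum_(i < b) wedge (evec (nat_delta K m (i + j))) (w i)) =
  \sum_(i < b) wedge (evec (nat_delta L m (i + j))) (map_exterior (w i)).
Proof.
have mapD : {morph map_exterior : u v / u + v}.
  by move=> u v; apply/ffunP => A; rewrite !ffunE rmorphD.
rewrite (big_morph _ mapD map_exterior0); apply: eq_bigr => i _; rewrite map_wedge_evec.
have -> // : map_mx phi (nat_delta K m (i + j)) = nat_delta L m (i + j).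
by apply/rowP => k; rewrite !mxE rmorph_nat.
Qed.

End BaseChange.

Arguments map_exterior {K L} phi {m} u.

(** Over the rational function field K(X) the powers of X are m distinct nodes,
and the coefficients of the system are unchanged by the extension. *)
Lemma hankel_inj (K : fieldType) m b c (w : nat -> exterior K m) :
    (b + c < m)%N ->
    (forall j, (j <= c)%N ->
       \sum_(i < b.+1) wedge (evec (nat_delta K m (i + j))) (w i) = 0) ->
  forall i (B : {set 'I_m}), (i <= b)%N -> #|B| = c -> w i B = 0.
Proof.
move=> ltbc hankel0 i B le_ib cB.
pose L : fieldType := {fraction {poly K}}.
pose phi : {rmorphism K -> L} := @tofrac {poly K} \o polyC.
pose x (k : 'I_m) : L := tofrac 'X^k.
have x_inj : injective x.
  move=> k l /eqP; rewrite tofrac_eq => /eqP/(congr1 (size \o polyseq)) /=.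
  by rewrite !size_polyXn => -[/val_inj].
apply: (fmorph_inj phi); rewrite rmorph0.
have := @hankel_inj_points L m x b c (fun i => map_exterior phi (w i)) x_inj ltbc.
move=> /(_ _ i B le_ib cB); rewrite ffunE; apply=> j le_jc.
by rewrite -map_hankel_sum hankel0 // map_exterior0.
Qed.

(** * Kronecker sums of homomorphisms *)

Lemma sum_mxtens (V : nmodType) m n (F : 'I_(m * n) -> V) :
  \sum_ij F ij = \sum_(i < m) \sum_(j < n) F (mxtens_index (i, j)).
Proof.
rewrite pair_big (reindex (@mxtens_index m n)) /=; last first.
  by exists (@mxtens_unindex m n) => ij _; rewrite (mxtens_indexK, mxtens_unindexK).
by apply: eq_bigr => -[].
Qed.

Section HomMatrix.
Variables (K : fieldType) (U V : vectType K) (s r : nat).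
Variables (e : s.-tuple U) (f : r.-tuple V).

Hypotheses (he : basis_of fullv e) (hf : basis_of fullv f).

Lemma coord_eq0 (v : V) : (forall i, coord f i v = 0) -> v = 0.
Proof.
move=> v0; rewrite (coord_basis hf (memvf v)) big1 // => i _.
by rewrite v0 scale0r.
Qed.

(** A vector of K^s (x) K^b is a b-tuple of vectors of U given by coordinates in
e, so injectivity on coordinates is injectivity on these tuples. *)
Lemma rank_sum_tensmx n a b (h : 'I_n -> 'Hom(U, V)) (T : 'I_n -> 'M[K]_(a, b)) :
    (forall w : 'I_b -> U,
       (forall i, \sum_k \sum_j T k i j *: h k (w j) = 0) ->
     forall j, w j = 0) ->
  \rank (\sum_k hom_mx e f (h k) *t T k)%R = (s * b)%N.
Proof.
move=> inj; rewrite -mxrank_tr; apply/eqP; rewrite -/(row_free _).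
set M := \sum_k _; apply: inj_row_free => y y0.
pose w j := \sum_i y 0 (mxtens_index (i, j)) *: e`_i.
have w0 : forall j, w j = 0.
  apply: inj => i; apply: coord_eq0 => i'.
  transitivity ((y *m M^T) 0 (mxtens_index (i', i))).
    rewrite mxE sum_mxtens [RHS]exchange_big linear_sum /=.
    under [RHS]eq_bigr => j _ do under eq_bigr => i0 _ do
      rewrite mxE summxE mulr_sumr.
    under [RHS]eq_bigr => j _ do rewrite exchange_big /=.
    rewrite [RHS]exchange_big; apply: eq_bigr => k _ /=.
    rewrite linear_sum; apply: eq_bigr => j _ /=.
    rewrite linearZ /= (linear_sum (h k)) (linear_sum (coord f i')) mulr_sumr.
    apply: eq_bigr => i0 _; rewrite tensmxE mxE !linearZ /= mulrCA.
    by rewrite [T k i j * _]mulrC.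
  by rewrite y0 mxE.
apply/rowP => ij; rewrite mxE; case: (mxtens_indexP ij) => i j.
by move/freeP: (basis_free he) => /(_ _ (w0 j)) ->.
Qed.

End HomMatrix.

(** * Rank bounds *)

Section RankBounds.
Variable K : fieldType.

(** The hypothesis says that B is injective on the row space of A, which
therefore embeds in the space of rows of length q. *)
Lemma mxrank_le_separated m n q (A : 'M[K]_(m, n)) (B : 'M[K]_(n, q)) :
  (forall y : 'rV_m, y *m A *m B = 0 -> y *m A = 0) -> (\rank A <= q)%N.
Proof.
move=> sep; have kerAB : (kermx (A *m B) <= kermx A)%MS.
  apply/rV_subP => y /sub_kermxP; rewrite mulmxA => /sep.
  by move=> ?; apply/sub_kermxP.
have := mxrankS kerAB; rewrite !mxrank_ker leq_sub2lE ?rank_leq_row //.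
by move/leq_trans; apply; rewrite rank_leq_col.
Qed.

Lemma tensmx11 m n : (1%:M : 'M[K]_m) *t (1%:M : 'M_n) = 1%:M.
Proof.
apply/matrixP => i j; case: (mxtens_indexP i) => i1 i2.
case: (mxtens_indexP j) => j1 j2; rewrite tensmxE !mxE -natrM mulnb.
by rewrite (can_eq (@mxtens_indexK m n)) xpair_eqE.
Qed.

(** The two matrices are transposes of each other and their product is the
identity, so both have the largest rank that their sizes allow. *)
Lemma rank_tens1_pid r a b : (a <= b)%N ->
  \rank ((1%:M : 'M[K]_r) *t (pid_mx a : 'M_(a, b))) = (r * a)%N /\
  \rank ((1%:M : 'M[K]_r) *t (pid_mx a : 'M_(b, a))) = (r * a)%N.
Proof.
move=> le_ab; set P := (X in \rank X = _ /\ _); set Q := (X in _ /\ \rank X = _).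
have PQ : P *m Q = 1%:M.
  by rewrite tensmx_mul mulmx1 pid_mx_id // pid_mx_1 tensmx11.
split; apply/eqP; rewrite eqn_leq.
  by rewrite rank_leq_row -{1}(@mxrank1 K (r * a)) -PQ mxrankM_maxl.
by rewrite rank_leq_col -{1}(@mxrank1 K (r * a)) -PQ mxrankM_maxr.
Qed.

(** Sandwiching A between P and Q deletes the last row and column of each
coefficient matrix. By Sylvester's inequality the left factor costs
r(d+1) - rd = r in rank, and the right factor costs s. *)
Lemma blowup_rank_truncate r s (X : {vspace 'M[K]_(r, s)}) d :
  (mxspace_rank (blowup X (d + 1) (d + 1)) <=
     mxspace_rank (blowup X d d) + r + s)%N.
Proof.
have [[A XA <-] _] := mxspace_rankP (blowup X (d + 1) (d + 1)).
have [_ maxX] := mxspace_rankP (blowup X d d).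
have [rP _] := @rank_tens1_pid r d (d + 1) (leq_addr _ _).
have [_ rQ] := @rank_tens1_pid s d (d + 1) (leq_addr _ _).
move: rP rQ; set P := _ *t _; set Q := _ *t _ => rP rQ.
have XPAQ : P *m A *m Q \in blowup X d d.
  have [n [B [T [XB ->]]]] := (blowupP _ _).1 XA.
  apply/blowupP; exists n, B, (fun i => pid_mx d *m T i *m pid_mx d).
  split=> //; rewrite mulmx_sumr mulmx_suml; apply: eq_bigr => i _.
  by rewrite !tensmx_mul mul1mx mulmx1.
have := maxX _ XPAQ; have := mxrank_mul_min P A; have := mxrank_mul_min (P *m A) Q.
rewrite rP rQ; move: (\rank (P *m A *m Q)) (\rank (P *m A)) => r1 r2.
move: (\rank A) (mxspace_rank _) => r3 r4.
lia.
Qed.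

End RankBounds.

(** * The rank of exterior multiplication by a nonzero vector *)

Section WedgeRank.
Variables (K : fieldType) (m : nat).

Definition sets_through (k : 'I_m) q : {set {set 'I_m}} :=
  [set S : {set 'I_m} | (#|S| == q) && (k \in S)].

Lemma card_sets_through k q :
  (#|sets_through k q| + 'C(m.-1, q))%N = 'C(m, q).
Proof.
have <- : #|[set~ k]| = m.-1 by rewrite cardsC1 card_ord.
have <- : #|[set S : {set 'I_m} | #|S| == q]| = 'C(m, q).
  by rewrite card_draws card_ord.
rewrite -cards_draws -cardsUI.
have disj : sets_through k q :&:
    [set A : {set 'I_m} | A \subset [set~ k] & #|A| == q] = set0.
  apply/setP => S; rewrite !inE subsetC sub1set inE.
  by case: (k \in S); rewrite ?andbF.
rewrite disj cards0 addn0.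
apply: eq_card => S; rewrite !inE subsetC sub1set inE.
by case: (k \in S); rewrite ?andbT ?andbF ?orbF.
Qed.

Lemma wedge_extpow_eq0 q (x : 'rV[K]_m) (k : 'I_m) (u : subvs_of (extpow K m q)) :
    x 0 k != 0 -> wedge (evec x) (vsval u) = 0 ->
    (forall S, S \in sets_through k q -> vsval u S = 0) ->
  u = 0.
Proof.
move=> xk xu0 u0; apply: val_inj; apply: wedge_evec_eq0 xk xu0 _ => S kS.
have [cS|cS] := eqVneq #|S| q; first by rewrite u0 // inE cS eqxx.
exact: (extpowP _ _ (subvsP u)).
Qed.

Definition coord_mx q n (g : n.-tuple (subvs_of (extpow K m q)))
    (P : {set {set 'I_m}}) : 'M[K]_(n, #|P|) :=
  \matrix_(i, j) vsval g`_i (enum_val j).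

Lemma mul_coord_mx_eq0 q n (g : n.-tuple (subvs_of (extpow K m q))) P (y : 'rV_n) :
  y *m coord_mx g P = 0 ->
  forall S, S \in P -> vsval (\sum_i y 0 i *: g`_i) S = 0.
Proof.
move=> y0 S PS; move/rowP/(_ (enum_rank_in PS S)): y0; rewrite !mxE => <-.
rewrite linear_sum sum_ffunE; apply: eq_bigr => i _.
by rewrite mxE enum_rankK_in // linearZ ffunE.
Qed.

(** Multivectors killed by x are separated by their coordinates on the sets
through k. Applied to the image, in degree p + 1, this gives the upper bound
C(m, p+1) - C(m-1, p+1) = C(m-1, p); applied to the kernel, in degree p, it
gives the lower bound C(m, p) - (C(m, p) - C(m-1, p)). *)
Lemma rank_leftwedge p s r (e : s.-tuple (subvs_of (extpow K m p)))
    (f : r.-tuple (subvs_of (extpow K m p.+1))) (x : 'rV[K]_m) :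
    basis_of fullv e -> basis_of fullv f -> x != 0 ->
  \rank (hom_mx e f (leftwedge p x)) = 'C(m.-1, p).
Proof.
move=> he hf; case/rV0Pn => k xk.
set h := leftwedge p x; rewrite -mxrank_tr; set N := _^T.
have mulN (y : 'rV_s) : y *m N = \row_i coord f i (h (\sum_j y 0 j *: e`_j)).
  apply/rowP => i; rewrite !mxE (linear_sum h) (linear_sum (coord f i)).
  by apply: eq_bigr => j _; rewrite !mxE !linearZ.
have m_gt0 : (0 < m)%N := leq_ltn_trans (leq0n k) (ltn_ord k).
have sE : s = 'C(m, p) by rewrite -(dim_extpow K) -(size_basis he) dimvf.
apply/eqP; rewrite eqn_leq; apply/andP; split.
  have -> : 'C(m.-1, p) = #|sets_through k p.+1|.
    apply: (@addnI 'C(m.-1, p.+1)); rewrite -binS prednK //.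
    by rewrite -(card_sets_through k) addnC.
  apply: (@mxrank_le_separated _ _ _ _ N (coord_mx f (sets_through k p.+1))).
  move=> y /mul_coord_mx_eq0 yN0.
  suff hy0 : h (\sum_j y 0 j *: e`_j) = 0.
    by rewrite mulN hy0; apply/rowP => i; rewrite !mxE linear0.
  apply: (wedge_extpow_eq0 xk) => [|S PS].
    by rewrite leftwedgeE wedge_evec2.
  rewrite -(yN0 S PS) mulN; under [in RHS]eq_bigr do rewrite mxE.
  by rewrite -(coord_basis hf) ?memvf.
have : (\rank (kermx N) <= #|sets_through k p|)%N.
  apply: (@mxrank_le_separated _ _ _ _ _ (coord_mx e (sets_through k p))).
  move=> y; have: y *m kermx N *m N = 0 by rewrite -mulmxA mulmx_ker mulmx0.
  move: (y *m kermx N) => z zN0 /mul_coord_mx_eq0 z0.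
  have uz0 : \sum_j z 0 j *: e`_j = 0.
    apply: (wedge_extpow_eq0 xk) => //; rewrite -leftwedgeE.
    have -> : leftwedge p x (\sum_j z 0 j *: e`_j) = 0; last by rewrite linear0.
    apply: (coord_eq0 hf) => i.
    by move/rowP/(_ i): zN0; rewrite mulN !mxE.
  apply/rowP => j; rewrite mxE.
  by move/freeP: (basis_free he) => /(_ _ uz0) ->.
have := card_sets_through k p; have := rank_leq_row N.
rewrite mxrank_ker; move: (\rank N) sE => rN; lia.
Qed.

Lemma rank_leftwedge0 p s r (e : s.-tuple (subvs_of (extpow K m p)))
    (f : r.-tuple (subvs_of (extpow K m p.+1))) :
  \rank (hom_mx e f (leftwedge p 0)) = 0%N.
Proof.
have -> : leftwedge p (0 : 'rV[K]_m) = 0.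
  apply/lfunP => w; apply: val_inj; rewrite zero_lfunE /= leftwedgeE.
  by rewrite -(scale0r (0 : 'rV[K]_m)) linearZ wedgeZl scale0r.
by rewrite linear0 mxrank0.
Qed.

End WedgeRank.

(** * A full-rank element of the blow-up *)

Lemma sum_parity (V : nmodType) (n : nat) (o : bool) (G : nat -> V) :
  \sum_(c < n.*2 | odd c == o) G c = \sum_(i < n) G (o + i.*2)%N.
Proof.
elim: n => [|n IHn]; first by rewrite !big_ord0.
rewrite doubleS big_mkcond !big_ord_recr /= -big_mkcond IHn -addrA odd_double.
by congr (_ + _); case: (o); rewrite ?add0r ?addr0.
Qed.

Section DoubledHankel.
Variable K : fieldType.

(** For even d, two copies of the Hankel matrix [i + j = k] of size d / 2,
interleaved: one on the even and one on the odd indices. Interleaving, rather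
than stacking the blocks, gives the matrix any size d without casts. *)
Definition doubled_hankel d (k : nat) : 'M[K]_d :=
  \matrix_(i, j) ((i./2 + j./2 == k)%N && (odd i == odd j))%:R.

Lemma nat_deltaE m l :
  nat_delta K m l = \sum_(k < m) (l == k :> nat)%:R *: delta_mx 0 k.
Proof.
apply/rowP => k; rewrite summxE (bigD1 k) //= big1 => [|j /negPf jk].
  by rewrite !mxE !eqxx mulr1 addr0 eq_sym.
by rewrite !mxE [k == j]eq_sym jk andbF mulr0.
Qed.

Lemma vsval_sum (V : vectType K) (E : {vspace V}) n (F : 'I_n -> subvs_of E) :
  vsval (\sum_i F i) = \sum_i vsval (F i).
Proof. exact: linear_sum. Qed.

(** The even and the odd components of w satisfy two separate Hankel systems,
in which index j stands for the position j./2 within its copy. *)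
Lemma doubled_hankel_inj m p d (w : 'I_d -> subvs_of (extpow K m p)) :
    (p + p < m)%N -> d = p.+1.*2 ->
    (forall i : 'I_d, \sum_(k < m) \sum_(j < d)
       doubled_hankel d k i j *: leftwedge p (delta_mx 0 k) (w j) = 0) ->
  forall j, w j = 0.
Proof.
move=> ltpm dE; subst d => w0.
pose W n : exterior K m := oapp (vsval \o w) 0 (insub n).
have WE (j : 'I_p.+1.*2) : W j = vsval (w j) by rewrite /W valK.
have hankel0 (o : bool) j : (j <= p)%N ->
    \sum_(i < p.+1) wedge (evec (nat_delta K m (i + j))) (W (o + i.*2)%N) = 0.
  move=> le_jp.
  have lt_oj : (o + j.*2 < p.+1.*2)%N.
    by rewrite doubleS !ltnS (leq_add (leq_b1 o)) // leq_double.
  have w0o : \sum_(c < p.+1.*2) \sum_(k < m) doubled_hankel p.+1.*2 k (Ordinal lt_oj) c *: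
      wedge (evec (delta_mx 0 k)) (W c) = 0.
    rewrite exchange_big; transitivity (vsval (0 : subvs_of (extpow K m p.+1))) => //.
    rewrite -(w0 (Ordinal lt_oj)) vsval_sum; apply: eq_bigr => k _.
    rewrite vsval_sum; apply: eq_bigr => c _.
    by rewrite WE -leftwedgeE.
  rewrite -[RHS]w0o.
  pose G n := wedge (evec (nat_delta K m (n./2 + j))) (W n).
  transitivity (\sum_(c < p.+1.*2 | odd c == o) G c).
    rewrite sum_parity; apply: eq_bigr => i _.
    by rewrite /G half_bit_double.
  rewrite big_mkcond; apply: eq_bigr => c _.
  under [RHS]eq_bigr do rewrite mxE /= half_bit_double.
  rewrite -wedge_evec_comb oddD odd_double addbF oddb eq_sym.
  case: eqP => _.
    by under eq_bigr do rewrite andbT; rewrite -nat_deltaE addnC.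
  by rewrite big1 ?linear0 ?wedge0l // => k _; rewrite andbF scale0r.
move=> c; apply: val_inj; rewrite /= -WE; apply/ffunP => B; rewrite ffunE.
have [cB|cB] := eqVneq #|B| p; last by rewrite WE; apply: (extpowP _ _ (subvsP _)).
rewrite -(odd_double_half c).
apply: (hankel_inj (w := fun i => W (odd c + i.*2)%N) ltpm (hankel0 (odd c))) => //.
by rewrite -ltnS ltn_half_double.
Qed.

Lemma blowup_wedge_full m p d s r (e : s.-tuple (subvs_of (extpow K m p)))
    (f : r.-tuple (subvs_of (extpow K m p.+1))) :
    basis_of fullv e -> basis_of fullv f -> (p + p < m)%N -> d = p.+1.*2 ->
  exists2 A, A \in blowup (wedge_mxspace e f) d d & \rank A = (s * d)%N.
Proof.
move=> he hf ltpm dE.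
exists (\sum_(k < m) hom_mx e f (leftwedge p (delta_mx 0 k)) *t doubled_hankel d k).
  apply/blowupP; exists m, (fun k => hom_mx e f (leftwedge p (delta_mx 0 k))).
  exists (fun k => doubled_hankel d k); split=> // k.
  by apply/wedge_mxspaceP; exists (delta_mx 0 k).
apply: (rank_sum_tensmx he hf) => w w0.
exact: doubled_hankel_inj ltpm dE w0.
Qed.

End DoubledHankel.

(** * Ranks of the wedge space and of its blow-ups *)

Theorem theorem1p10 (K : fieldType) (p m : nat) (hm : m = (2 * p + 1)%N)
    (e : 'C(2 * p + 1, p).-tuple (subvs_of (extpow K m p)))
    (f : 'C(2 * p + 1, p).-tuple (subvs_of (extpow K m p.+1)))
    (he : basis_of fullv e) (hf : basis_of fullv f) :
  [/\ mxspace_rank (wedge_mxspace e f) = 'C(2 * p, p),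
      mxspace_rank (blowup (wedge_mxspace e f) (m + 1) (m + 1)) =
        ((m + 1) * 'C(2 * p + 1, p))%N
    & 'C(2 * p, p)%:Z * (2 * m%:Z - 4) <
        (mxspace_rank (blowup (wedge_mxspace e f) m m))%:Z].
Proof.
have mE : m.-1 = (2 * p)%N by rewrite hm addn1.
have rank2 : mxspace_rank (blowup (wedge_mxspace e f) (m + 1) (m + 1)) =
    ('C(2 * p + 1, p) * (m + 1))%N.
  have [[A _ <-] maxX] := mxspace_rankP (blowup (wedge_mxspace e f) (m + 1) (m + 1)).
  apply/eqP; rewrite eqn_leq rank_leq_row /=.
  have [||B XB rB] := blowup_wedge_full (d := m + 1) he hf; try by lia.
  by apply: leq_trans (maxX B XB); rewrite rB.
split; last 2 first.
- by rewrite rank2 mulnC.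
(* The truncation leaves (m+1)D - 2D, that is, 2m C - 2D with (p+1)D = m C,
   and 2D < 4C. *)
- have := blowup_rank_truncate (wedge_mxspace e f) m; rewrite rank2.
  have binE : ((2 * p).+1 * 'C(2 * p, p) = p.+1 * 'C(2 * p + 1, p))%N.
    rewrite addn1 (mul_bin_down (2 * p).+1 p); congr (_ * _)%N; lia.
  have C_gt0 : (0 < 'C(2 * p, p))%N by rewrite bin_gt0; lia.
  move: ('C(2 * p, p)) ('C(2 * p + 1, p)) (mxspace_rank _) binE C_gt0.
  move=> C D R' binE C_gt0 truncE.
  nia.
have [[A /wedge_mxspaceP[x ->] rk_x] maxX] := mxspace_rankP (wedge_mxspace e f).
apply/eqP; rewrite eqn_leq; apply/andP; split.
  rewrite -rk_x; have [->|x0] := eqVneq x 0; first by rewrite rank_leftwedge0.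
  by rewrite (rank_leftwedge he hf x0) mE.
have m_gt0 : (0 < m)%N by rewrite hm addn1.
pose x1 : 'rV[K]_m := delta_mx 0 (Ordinal m_gt0).
have x1_neq0 : x1 != 0.
  by apply/rV0Pn; exists (Ordinal m_gt0); rewrite mxE !eqxx oner_eq0.
have rk_x1 := rank_leftwedge he hf x1_neq0; rewrite mE in rk_x1.
apply: leq_trans (maxX (hom_mx e f (leftwedge p x1)) _); first by rewrite rk_x1.
by apply/wedge_mxspaceP; exists x1.
Qed.
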